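(* Let $n\ge2$ and let $\pi,\sigma\in\mathfrak{B}_n$ be selected independently and uniformly at random. Let $p_{n,2}=\mathbb{P}(\pi\text{ and }\sigma\text{ are comparable})$ and $p_{n,2,\le}=\mathbb{P}(\pi\le\sigma)$, with respect to Bruhat order. Then $$p_{n,2}=\frac15+\frac{6}{5n}+\sum_{k\ge1}\left(\frac{12}{5n^{2k}}-\frac{18}{5n^{2k+1}}\right)\quad\text{and}\quad p_{n,2,\le}=\frac1{10}+\frac{3}{5n}+\sum_{k\ge2}\frac{6}{5n^k}.$$ Thus $p_{n,2}\downarrow\frac15$ and $p_{n,2,\le}\downarrow\frac1{10}$ as $n\to\infty$ (i.e. each sequence decreases with $n$ to the stated limit).
   Context: $\mathfrak{S}_n$ is the set of permutations of $[n]=\{1,\dots,n\}$, in one-line notation. A reduction of $\omega\in\mathfrak{S}_n$ interchanges $\omega(i)$ and $\omega(j)$ for some $i<j$ with $\omega(i)>\omega(j)$. Bruhat order: $\pi\le\sigma$ if $\pi$ is obtained from $\sigma$ by a (possibly empty) sequence of reductions. $\mathfrak{B}_n\subseteq\mathfrak{S}_n$ is the set of bigrassmannian permutations, i.e. those $\omega$ such that both $\omega$ and $\omega^{-1}$ have exactly one descent; equivalently $\omega=1\cdots a\,(b+1)\cdots c\,(a+1)\cdots b\,(c+1)\cdots n$ for some $0\le a<b<c\le n$. $\pi,\sigma$ are comparable if $\pi\le\sigma$ or $\sigma\le\pi$. *)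

(* Defs.v *)
From mathcomp Require Import all_boot all_order all_algebra all_fingroup.
From mathcomp Require Import all_classical all_reals all_analysis.

Set Implicit Arguments.
Unset Strict Implicit.
Unset Printing Implicit Defensive.

Import Order.TTheory GRing.Theory Num.Theory.
Import numFieldNormedType.Exports.

Local Open Scope ring_scope.

(* Permutations of [n] = {1, ..., n} are modelled by 'S_n, acting on
   'I_n = {0, ..., n - 1}: both positions and values are shifted by one. *)

(* As (s * t) x = t (s x) in MathComp, tperm i j * s is s with the entries in
   positions i and j of its one-line notation interchanged. *)
Definition is_reduction n (s t : 'S_n) : bool :=
  [exists i : 'I_n, exists j : 'I_n,
     [&& (i < j)%N, (s j < s i)%N & t == (tperm i j * s)%g]].

(* connect e s t means that t is reachable from s, so s is the larger one. *)
Definition bruhat_le n (p s : 'S_n) : bool := connect (@is_reduction n) s p.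

Definition bruhat_comparable n (p s : 'S_n) : bool :=
  bruhat_le p s || bruhat_le s p.

Definition descents n (s : 'S_n) : {set 'I_n} :=
  [set i : 'I_n | [exists j : 'I_n, (j == i.+1 :> nat) && (s j < s i)%N]].

Definition bigrassmannian n : {set 'S_n} :=
  [set s : 'S_n | (#|descents s| == 1)%N && (#|descents (s^-1)%g| == 1)%N].

Definition uniform_pmf (R : realType) (T : finType) (A : {set T}) (x : T) : R :=
  if x \in A then #|A|%:R^-1 else 0.

(* Probability of the event E x y, for independent x and y with probability
   mass functions f and g. *)
Definition indep_prob (R : realType) (T U : finType) (f : T -> R) (g : U -> R)
    (E : T -> U -> bool) : R :=
  \sum_(x : T) \sum_(y : U | E x y) f x * g y.

Definition p_comparable (R : realType) (n : nat) : R :=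
  indep_prob (uniform_pmf R (bigrassmannian n))
             (uniform_pmf R (bigrassmannian n)) (@bruhat_comparable n).

Definition p_le (R : realType) (n : nat) : R :=
  indep_prob (uniform_pmf R (bigrassmannian n))
             (uniform_pmf R (bigrassmannian n)) (@bruhat_le n).

(* Main.v *)
(** Every bigrassmannian permutation consists of four blocks: it fixes the first
    [a] entries, interchanges the next two blocks of lengths [m] and [k], and
    fixes the rest.  Among the permutations with at most [a] of the first
    [a + m] values below [a + k] it is the Bruhat-least one: a minimal such
    permutation admits no reduction preserving that bound, so it can only
    descend at position [a + m], and its inverse only at [a + k], which
    determines it.  Hence (a, k, m) <= (a', k', m') amounts to a' <= a, k <= k',
    m <= m' and a + k + m <= a' + k' + m'.  A fixed (a', k', m') therefore has
    k' m' (k' + m') / 2 elements below it, and summing gives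
    p_le = (n + 2)(n + 3) / (10 n (n - 1)).  By antisymmetry
    p_comparable = 2 p_le - 1 / 'C(n + 1, 3).  The series are geometric. *)

Require Import Defs.
From mathcomp Require Import all_boot all_order all_algebra all_fingroup.
From mathcomp Require Import all_classical all_reals all_analysis.
From mathcomp Require Import zify ring lra.

Set Implicit Arguments.
Unset Strict Implicit.
Unset Printing Implicit Defensive.

Import Order.TTheory GRing.Theory Num.Theory.
Import numFieldNormedType.Exports.

(** * Indicator sums, rank functions and four-block permutations *)

Lemma sum_interval (s e p : nat) : (\sum_(0 <= i < p) (s <= i < e) = minn p e - s)%N.
Proof.
elim: p => [|p IH]; first by rewrite big_geq // min0n.
by rewrite big_nat_recr //= IH; case: (leqP p e) => ?; case: (leqP p.+1 e) => ?; lia.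
Qed.

Lemma sum_lt_ord n x : (x <= n)%N -> (\sum_(j < n) (j < x) = x)%N.
Proof.
move=> xn; rewrite -(big_mkord xpredT (fun j => (j < x : nat))).
by rewrite (sum_interval 0) subn0 (minn_idPr xn).
Qed.

Section Rank.
Variable n : nat.
Implicit Types (s t w : 'S_n) (p q : nat).

(** The rank function of the permutation matrix at the corner (p, q). It can only grow when
    descending in Bruhat order. *)
Definition low w p q := \sum_(i < n) ((i < p) && (w i < q)).

(** Only the summands at i and j change; the balancing terms on both sides avoid subtraction in nat.
    A general [F] serves both the rank function and the sum of the i * t i. *)
Lemma sum_tperm (F : nat -> nat -> nat) s (i j : 'I_n) : i != j ->
  (\sum_(x < n) F x ((tperm i j * s)%g x) + F i (s i) + F j (s j)
  = \sum_(x < n) F x (s x) + F j (s i) + F i (s j))%N.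
Proof.
move=> nij; have nji : j != i by rewrite eq_sym.
rewrite (bigD1 i) //= (bigD1 j) //= !permM tpermL tpermR.
rewrite [X in _ = (X + _ + _)%N](bigD1 i) //= [X in _ = (_ + X + _ + _)%N](bigD1 j) //=.
set S := \sum_(_ < _ | _) _; set S' := \sum_(_ < _ | _) _.
suff -> : S = S' by move: (F i (s j)) (F j (s i)) (F i (s i)) (F j (s j)) => *; lia.
by apply: eq_bigr => x /andP[xi xj]; rewrite permM tpermD // eq_sym.
Qed.

Lemma low_tperm s (i j : 'I_n) p q : i != j ->
  (low (tperm i j * s)%g p q + ((i < p) && (s i < q)) + ((j < p) && (s j < q))
  = low s p q + ((j < p) && (s i < q)) + ((i < p) && (s j < q)))%N.
Proof. exact: (sum_tperm (fun x y => (x < p) && (y < q))). Qed.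

(** The rank changes by ((i < p) - (j < p)) ((s j < q) - (s i < q)), a product of two nonnegative
    factors. *)
Lemma low_reduction s t p q : is_reduction s t -> (low s p q <= low t p q)%N.
Proof.
case/existsP=> i /existsP[j /and3P[ij sji /eqP->]].
have nij : i != j by rewrite -val_eqE /= ltn_eqF.
have := low_tperm s p q nij; lia.
Qed.

Lemma low_bruhat s t p q : bruhat_le t s -> (low s p q <= low t p q)%N.
Proof.
case/connectP=> r; elim: r s => [|u r IH] s /=; first by move=> _ ->.
by case/andP=> su ur tE; apply: leq_trans (low_reduction p q su) (IH u ur tE).
Qed.

Lemma sum_perm_lt w x : (x <= n)%N -> (\sum_(j < n) (w j < x) = x)%N.
Proof.
move=> xn.
rewrite -(reindex_inj (@perm_inj _ w) (P := xpredT) (F := fun j : 'I_n => (j < x : nat))).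
exact: sum_lt_ord.
Qed.

(* No descent except possibly between the 0-based positions p - 1 and p. *)
Definition only_descent p w :=
  forall i j : 'I_n, (i < j)%N -> (j < p)%N || (p <= i)%N -> (w i < w j)%N.

(** Two positions on the same side of p are joined by adjacent steps, none of which goes from p - 1
    to p. *)
Lemma only_descent_adj p w :
  (forall i j : 'I_n, j = i.+1 :> nat -> j != p :> nat -> (w i < w j)%N) -> only_descent p w.
Proof.
move=> H i j; have [d jd] : exists d, (j <= i + d)%N by exists j; lia.
elim: d i jd => [|d IH] i jd ij ijp; first lia.
have i1n : (i.+1 < n)%N by have := ltn_ord j; lia.
have [ji|ij1] := eqVneq (j : nat) i.+1; first by apply: H => //; lia.
apply: (@ltn_trans (w (Ordinal i1n))); first by apply: H => //=; lia.
by apply: IH => /=; lia.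
Qed.

Definition bgf a k m i :=
  if (i < a)%N then i else if (i < a + m)%N then (i + k)%N
  else if (i < a + m + k)%N then (i - m)%N else i.

(* Meaningful only when a + k + m <= n. *)
Definition bg a k m : 'S_n :=
  insubd (1%g : 'S_n) [ffun i : 'I_n => insubd i (bgf a k m i)].

Lemma bgE a k m : (a + k + m <= n)%N -> forall i, bg a k m i = bgf a k m i :> nat.
Proof.
move=> akm i.
have E (j : 'I_n) : val (insubd j (bgf a k m j)) = bgf a k m j.
  rewrite val_insubd /=; case: ifP => // /negP[].
  by have := ltn_ord j; rewrite /bgf; do ?case: ifP => ?; lia.
rewrite /bg -pvalE val_insubd; case: ifP => [_|/negP[]]; first by rewrite ffunE E.
apply/injectiveP => x y; rewrite !ffunE => /(congr1 val); rewrite !E => xy.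
by apply: val_inj => /=; move: xy; rewrite /bgf; do ?case: ifP => ?; lia.
Qed.

(** Cutting positions at p and values at q gives four classes, whose sizes are fixed by the rank L.
    Comparisons with i are determined inside each class, so counting the values below w i determines
    w i. *)
Lemma only_descent_bg p q w : (p <= n)%N -> (q <= n)%N ->
    only_descent p w -> only_descent q (w^-1)%g ->
  [/\ (low w p q <= p)%N, (low w p q <= q)%N, (p + q <= n + low w p q)%N
    & w = bg (low w p q) (q - low w p q) (p - low w p q)].
Proof.
move=> pn qn Hp Hq; set L := low w p q.
have Lp : (L <= p)%N.
  by rewrite -[leqRHS](sum_lt_ord pn); apply: leq_sum => i _; lia.
have Lq : (L <= q)%N.
  by rewrite -[leqRHS](sum_perm_lt w qn); apply: leq_sum => i _; lia.
(* Inclusion-exclusion: n - p - q + L counts the positions from p on with values from q on. *)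
have Ln : (p + q <= n + L)%N.
  have : (\sum_(j < n) (j < p) + \sum_(j < n) (w j < q) <= \sum_(j < n) (j < n) + L)%N.
    by rewrite -!big_split; apply: leq_sum => i _ /=; have := ltn_ord i; lia.
  by rewrite !sum_lt_ord // sum_perm_lt.
split=> //; apply/permP => i; apply: val_inj; rewrite /= bgE; last lia.
have F1 (x y : 'I_n) : (x < y)%N -> (y < p)%N || (p <= x)%N -> (w x < w y)%N := Hp x y.
have F2 (x y : 'I_n) : (w x < w y)%N -> (w y < q)%N || (q <= w x)%N -> (x < y)%N.
  by move=> /Hq /[apply]; rewrite !permK.
have iE := sum_lt_ord (ltnW (ltn_ord i)).
have wE := sum_perm_lt w (ltnW (ltn_ord (w i))).
have pE := sum_lt_ord pn; have qE := sum_perm_lt w qn.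
have inE := sum_lt_ord (ltn_ord i).
have I (j : 'I_n) : j = i :> nat -> w j = w i :> nat by move/val_inj->.
(* If j lies on the same side as i for positions or for values, monotonicity of w or of its inverse
   makes both orders agree. The remaining, diagonally opposite class is settled by the cuts
   themselves. *)
have K (j : 'I_n) : ((j < p) = (i < p))%N \/ ((w j < q) = (w i < q))%N ->
    ((w j < w i) = (j < i))%N.
  move=> H; have J : w j = w i :> nat -> j = i :> nat by move/val_inj/perm_inj->.
  have := F1 i j; have := F2 i j; have := F1 j i; have := F2 j i.
  have [ji|ij|/val_inj->] := ltngtP j i; last by rewrite ltnn.
    by case: H => H; move=> *; lia.
  by case: H => H; move=> *; lia.
have [ip|ip] := ltnP i p; have [iq|iq] := ltnP (w i) q.
- have wi : w i = i :> nat.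
    rewrite -[LHS]wE -[RHS]iE; apply: eq_bigr => j _; congr nat_of_bool.
    by move: (I j) (K j);
      case: (ltnP j p) => ?; case: (ltnP (w j) q) => ?; lia.
  have : (i < L)%N.
    rewrite -inE; apply: leq_sum => j _.
    by move: (I j) (K j);
      case: (ltnP j p) => ?; case: (ltnP (w j) q) => ?; lia.
  by rewrite /bgf => ->.
- have wi : (w i + L = q + i)%N.
    rewrite -[in LHS]wE -[in RHS]iE -[in RHS]qE /L /low -!big_split.
    by apply: eq_bigr => j _ /=; move: (I j) (K j);
      case: (ltnP j p) => ?; case: (ltnP (w j) q) => ?; lia.
  have Li : (L <= i)%N.
    by rewrite -iE; apply: leq_sum => j _; move: (I j) (K j);
      case: (ltnP j p) => ?; case: (ltnP (w j) q) => ?; lia.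
  by rewrite /bgf; do ?case: ifP => ?; lia.
- have wi : (w i + p = L + i)%N.
    rewrite -[in LHS]wE -[in RHS]iE -[in LHS]pE /L /low -!big_split.
    by apply: eq_bigr => j _ /=; move: (I j) (K j);
      case: (ltnP j p) => ?; case: (ltnP (w j) q) => ?; lia.
  by rewrite /bgf; do ?case: ifP => ?; lia.
- have wi : w i = i :> nat.
    rewrite -[LHS]wE -[RHS]iE; apply: eq_bigr => j _; congr nat_of_bool.
    by move: (I j) (K j);
      case: (ltnP j p) => ?; case: (ltnP (w j) q) => ?; lia.
  (* Every j with j < p or w j < q precedes i, and there are p + q - L of them. *)
  have : (p + q <= i + L)%N.
    rewrite -[in leqLHS]pE -[in leqLHS]qE -[in leqRHS]iE /L /low -!big_split.
    by apply: leq_sum => j _ /=; move: (I j) (K j);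
      case: (ltnP j p) => ?; case: (ltnP (w j) q) => ?; lia.
  by rewrite /bgf; do ?case: ifP => ?; lia.
Qed.

Lemma bgfP a k m i :
  [\/ (i < a)%N /\ bgf a k m i = i, (a <= i < a + m)%N /\ bgf a k m i = (i + k)%N,
      (a + m <= i < a + m + k)%N /\ bgf a k m i = (i - m)%N
    | (a + m + k <= i)%N /\ bgf a k m i = i].
Proof.
rewrite /bgf; case: ltnP => [?|?]; first by constructor 1.
case: ltnP => ?; first by constructor 2.
by case: ltnP => ?; [constructor 3|constructor 4].
Qed.

(** One summand per block: within a block, the conditions i < p and w i < q cut out an interval of
    positions. *)
Lemma low_bg a k m p q : (a + k + m <= n)%N -> (p <= n)%N ->
  low (bg a k m) p q = (minn p (minn q a) + (minn p (minn (a + m) (q - k)) - a)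
     + (minn p (minn (a + m + k) (q + m)) - (a + m)) + (minn p q - (a + k + m)))%N.
Proof.
move=> akm pn; rewrite /low.
under eq_bigr do rewrite bgE //.
rewrite -(big_mkord xpredT (fun i => ((i < p) && (bgf a k m i < q) : nat))).
have pE e : minn p e = minn n (minn p e) by rewrite minnA (minn_idPr pn).
rewrite -[minn p (minn q a)]subn0 (pE (minn q a)) (pE (minn (a + m) _)).
rewrite (pE (minn (a + m + k) _)) (pE q) -!sum_interval -!big_split.
apply: eq_bigr => i _; rewrite /= !leq_min.
by case: (bgfP a k m i) => -[? ->]; lia.
Qed.

End Rank.

(** * Bruhat order on bigrassmannian permutations *)

Section Bruhat.
Variable n : nat.
Implicit Types (s t w : 'S_n) (p q : nat).

(** The upper set of a bigrassmannian permutation is cut out by one rank inequality. Monotonicity of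
    [low] makes it necessary; for sufficiency, one descends from s as far as the inequality
    allows. *)
Lemma bruhat_bg a k m s : (a + k + m <= n)%N -> (0 < k)%N -> (0 < m)%N ->
  bruhat_le (bg n a k m) s = (low s (a + m) (a + k) <= a)%N.
Proof.
move=> akm k0 m0; apply/idP/idP => [/(low_bruhat (a + m) (a + k))/leq_trans->//|ls].
  by rewrite low_bg //; lia.
(* Each reduction increases the sum of the i * t i, so a maximizer t admits no
   reduction that stays in P. *)
pose P := [pred t | connect (@is_reduction n) s t && (low t (a + m) (a + k) <= a)%N].
have Ps : P s by rewrite /= connect0.
case: (arg_maxnP (fun t : 'S_n => \sum_(i < n) i * t i)%N Ps) => t /andP[st lt] tmax.
have H (i j : 'I_n) : (i < j)%N -> (t j < t i)%N ->
    (a < low (tperm i j * t)%g (a + m) (a + k))%N.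
  move=> ij tji; rewrite ltnNge; apply/negP => lu.
  have nij : i != j by rewrite -val_eqE /= ltn_eqF.
  have /tmax : P (tperm i j * t)%g.
    rewrite /= lu andbT; apply: connect_trans st (connect1 _).
    by apply/existsP; exists i; apply/existsP; exists j; rewrite ij tji /=.
  (* The swap raises the potential by (j - i) (t i - t j) > 0, against maximality. *)
  have /= := sum_tperm muln t nij; set M := \sum_(x < n) _; set M' := \sum_(x < n) _.
  move: M M' ij tji; move: (t i : nat) (t j : nat) (i : nat) (j : nat) => x y u v M M'; nia.
have pn : (a + m < n)%N by lia.
have qn : (a + k <= n)%N by lia.
(* Swapping adjacent positions on one side of a + m keeps the rank, so by [H] there is no descent
   there; likewise for the inverse at a + k. *)
have Hp : only_descent (a + m) t.
  apply: only_descent_adj => i j ij jp; rewrite ltnNge leq_eqVlt; apply/negP.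
  case/orP => [/eqP/val_inj/perm_inj ji|tji]; first by move: ij; rewrite ji; lia.
  have nij : i != j by rewrite -val_eqE /=; lia.
  have := H i j; have := low_tperm t (a + m) (a + k) nij.
  have -> : (i < a + m)%N = (j < a + m)%N by lia.
  lia.
have Hq : only_descent (a + k) (t^-1)%g.
  apply: only_descent_adj => x y xy yq; rewrite ltnNge leq_eqVlt; apply/negP.
  case/orP => [/eqP/val_inj/perm_inj ji|tji]; first by move: xy; rewrite ji; lia.
  have nij : (t^-1)%g y != (t^-1)%g x by rewrite -val_eqE /=; lia.
  have := H _ _ tji; have := low_tperm t (a + m) (a + k) nij.
  rewrite !permKV; have -> : (x < a + k)%N = (y < a + k)%N by lia.
  lia.
have [Lp Lq Ln tE] := only_descent_bg (ltnW pn) qn Hp Hq.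
move: Lp Lq Ln tE lt; set L := low _ _ _ => Lp Lq Ln tE.
rewrite leq_eqVlt => /orP[/eqP La|La].
  by rewrite /bruhat_le; move: tE st; rewrite La !addKn => ->.
(* If L < a, the reduction at the descent of t moves the value L < a + k into the first a + m
   positions and a value at least a + k out. The rank becomes L + 1 <= a, contradicting [H]. *)
have pn1 : (a + m).-1 < n by lia.
pose i := Ordinal pn1; pose j := Ordinal pn.
have nij : i != j by rewrite -val_eqE /=; lia.
have ti : (t i = (a + m).-1 + (a + k - L) :> nat)%N.
  by rewrite tE bgE /bgf /=; [do ?case: ifP => ?|]; lia.
have tj : t j = L :> nat.
  by rewrite tE bgE /bgf /=; [do ?case: ifP => ?|]; lia.
have := H i j; have := low_tperm t (a + m) (a + k) nij; rewrite -/L ti tj /=.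
lia.
Qed.

Lemma bgV a k m : (a + k + m <= n)%N -> ((bg n a k m)^-1)%g = bg n a m k.
Proof.
move=> akm; apply: (mulgI (bg n a k m)); rewrite mulgV; apply/permP => i.
apply: val_inj; rewrite perm1 permM /= bgE ?bgE //; last lia.
have := ltn_ord i.
by case: (bgfP a k m i) => -[? ->]; rewrite /bgf; do ?case: ifP => ?; lia.
Qed.

(** The descent is where the two exchanged blocks meet, at the 0-based position a + m - 1. *)
Lemma descents_bg a k m : (a + k + m <= n)%N -> (0 < k)%N -> (0 < m)%N ->
  #|descents (bg n a k m)| = 1%N.
Proof.
move=> akm k0 m0; have pn : ((a + m).-1 < n)%N by lia.
rewrite -(cards1 (Ordinal pn)); congr #|pred_of_set _|; apply/setP => i.
rewrite !inE -val_eqE /=; apply/existsP/eqP => [[j /andP[/eqP ji]]|ip].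
  rewrite !bgE // ji => H; apply/eqP; apply: contraLR H => /eqP ip.
  by rewrite /bgf; do ?case: ifP => ?; lia.
have pn1 : (i.+1 < n)%N by lia.
exists (Ordinal pn1); rewrite eqxx !bgE //= /bgf.
by do ?case: ifP => ?; lia.
Qed.

Lemma bg_bigrassmannian a k m : (a + k + m <= n)%N -> (0 < k)%N -> (0 < m)%N ->
  bg n a k m \in bigrassmannian n.
Proof. by move=> akm k0 m0; rewrite inE bgV // !descents_bg //; lia. Qed.

Lemma descents1 w : #|descents w| = 1%N ->
  exists2 p, (p <= n)%N & only_descent p w.
Proof.
(* A descent at the 0-based position i is a cut after i + 1 entries. *)
move/eqP/cards1P => [i dE]; exists i.+1 => //.
apply: only_descent_adj => x y yx yi; rewrite ltnNge leq_eqVlt; apply/negP.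
case/orP => [/eqP/val_inj/perm_inj ji|wyx]; first by move: yx; rewrite ji; lia.
have : x \in descents w by rewrite inE; apply/existsP; exists y; rewrite yx eqxx.
by rewrite dE inE => /eqP xi; move: yi; rewrite yx xi eqxx.
Qed.

Lemma bigrassmannianP w : w \in bigrassmannian n ->
  exists a k m, [/\ (a + k + m <= n)%N, (0 < k)%N, (0 < m)%N & w = bg n a k m].
Proof.
rewrite inE => /andP[/eqP dw /eqP /descents1[q qn Hq]].
have [p pn Hp] := descents1 dw.
have [Lp Lq Ln wE] := only_descent_bg pn qn Hp Hq.
have akm : (low w p q + (q - low w p q) + (p - low w p q) <= n)%N by lia.
have km : (0 < q - low w p q)%N && (0 < p - low w p q)%N.
  (* With an empty block the permutation is the identity, which has no descent. *)
  apply: contra_eqT dw => km; rewrite wE.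
  rewrite eq_sym (_ : descents _ = finset.set0) ?cards0 //; apply/setP => i.
  rewrite !inE; apply/existsP => -[j /andP[/eqP ji]]; rewrite !bgE // ji => H.
  by move: H; rewrite /bgf; do ?case: ifP => ?; lia.
case/andP: km => k0 m0.
by exists (low w p q), (q - low w p q)%N, (p - low w p q)%N.
Qed.

End Bruhat.

(** The inequality of [bruhat_bg] at the corner (a + m, a + k), evaluated block by block on the
    larger permutation. *)
Lemma bruhat_bg_bg a k m a' k' m' n :
  (a + k + m <= n)%N -> (a' + k' + m' <= n)%N -> (0 < k)%N -> (0 < m)%N ->
  (0 < k')%N -> (0 < m')%N ->
  bruhat_le (bg n a k m) (bg n a' k' m') =
  [&& (a' <= a)%N, (k <= k')%N, (m <= m')%N & (a + k + m <= a' + k' + m')%N].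
Proof.
move=> akm akm' k0 m0 k0' m0'; rewrite bruhat_bg // low_bg //; last lia.
(* If a < a', the initial fixed entries alone already contribute more than a to the rank. *)
have [aa|aa] := leqP a' a; last first.
  rewrite /=; apply/negbTE; rewrite -ltnNge.
  apply: (@leq_trans (minn (a + m) (minn (a + k) a'))); last by rewrite -!addnA leq_addr.
  by rewrite !leq_min; lia.
rewrite (minn_idPr _); last by rewrite geq_min; lia.
rewrite (minn_idPr _); last by lia.
by do ?[case: leqP => ?]; lia.
Qed.

(** * Parametrization by triples *)

Section Triples.
Variable N : nat.

(* The triple (a, i, j) stands for bg a k m with k = i + 1 and m = j + 1 in
   'S_(N + 1). *)
Definition triples : {set 'I_N * 'I_N * 'I_N} :=
  [set t : 'I_N * 'I_N * 'I_N | (t.1.1 + t.1.2 + t.2 < N)%N].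

Definition bgt (t : 'I_N * 'I_N * 'I_N) : 'S_N.+1 := bg N.+1 t.1.1 t.1.2.+1 t.2.+1.

Definition below (t u : 'I_N * 'I_N * 'I_N) :=
  [&& (u.1.1 <= t.1.1)%N, (t.1.2 <= u.1.2)%N, (t.2 <= u.2)%N
    & (t.1.1 + t.1.2 + t.2 <= u.1.1 + u.1.2 + u.2)%N].

Lemma bruhat_bgt : {in triples &, forall t u, bruhat_le (bgt t) (bgt u) = below t u}.
Proof. by move=> t u; rewrite !inE => tN uN; rewrite bruhat_bg_bg; rewrite /below; lia. Qed.

Lemma below_anti : antisymmetric below.
Proof.
move=> [[a i] j] [[a' i'] j'] H; congr (_, _, _); apply/val_inj => /=;
by move: H; rewrite /below /=; lia.
Qed.

(** Triples with equal images lie below each other by reflexivity, hence coincide by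
    antisymmetry. *)
Lemma bgt_inj : {in triples &, injective bgt}.
Proof.
move=> t u tN uN tu; apply: below_anti.
by rewrite -!bruhat_bgt // tu /bruhat_le connect0.
Qed.

Lemma bigrassmannianE : bigrassmannian N.+1 = bgt @: triples.
Proof.
apply/setP => w; apply/idP/imsetP => [/bigrassmannianP[a [k [m [akm k0 m0 ->]]]]|[t]].
  have aN : (a < N)%N by lia.
  have kN : (k.-1 < N)%N by lia.
  have mN : (m.-1 < N)%N by lia.
  exists (Ordinal aN, Ordinal kN, Ordinal mN); first by rewrite inE /=; lia.
  by rewrite /bgt /= !prednK.
by rewrite inE => tN ->; apply: bg_bigrassmannian => //; lia.
Qed.

(** Independent full ranges, so that summations can be exchanged. *)
Lemma sum_triplesE (F : nat -> nat -> nat -> nat) :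
  (\sum_(t in triples) F t.1.1 t.1.2 t.2 =
   \sum_(a < N) \sum_(i < N) \sum_(j < N) if a + i + j < N then F a i j else 0)%N.
Proof.
rewrite big_mkcond /=; under eq_bigr do rewrite inE.
rewrite -(pair_bigA _ (fun (p : 'I_N * 'I_N) (j : 'I_N) =>
  if p.1 + p.2 + j < N then F p.1 p.2 j else 0)%N) /=.
by rewrite -(pair_bigA _ (fun a i : 'I_N => \sum_(j < N) if a + i + j < N then F a i j else 0)%N).
Qed.

(** Nested ranges, suited to induction on N by splitting off the layer a = 0. *)
Lemma sum_triples (F : nat -> nat -> nat -> nat) :
  (\sum_(t in triples) F t.1.1 t.1.2 t.2 =
   \sum_(a < N) \sum_(i < N - a) \sum_(j < N - a - i) F a i j)%N.
Proof.
rewrite sum_triplesE.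
apply: eq_bigr => a _.
rewrite (big_ord_widen N (fun i => \sum_(j < N - a - i) F a i j)%N) ?leq_subr //.
rewrite [RHS]big_mkcond; apply: eq_bigr => i _ /=.
case: ltnP => ia; last first.
  by apply: big1 => j _; case: ifP => //; lia.
rewrite (big_ord_widen N (F a i)); last by lia.
by rewrite [RHS]big_mkcond; apply: eq_bigr => j _ /=;
   do 2 case: ifP => //; lia.
Qed.

End Triples.

(** * Closed forms for the counts *)

Lemma sum_tri K : (2 * \sum_(i < K) (K - i) = K * K.+1)%N.
Proof.
elim: K => [|K IH]; first by rewrite big_ord0.
by rewrite big_ord_recl [LHS]mulnDr IH /=; lia.
Qed.

Lemma card_triples N : (6 * #|triples N| = N * N.+1 * N.+2)%N.
Proof.
rewrite -sum1_card (sum_triples N (fun _ _ _ => 1%N)).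
under eq_bigr => a _ do under eq_bigr => i _ do rewrite sum1_card card_ord.
elim: N => [|N IH]; first by rewrite big_ord0.
rewrite big_ord_recl [LHS]mulnDr IH subn0; have := sum_tri N.+1.
set S := \sum_(i < N.+1) _; move: S => S; lia.
Qed.

Lemma sum_lin (c J : nat) : (2 * \sum_(j < J) (c + (J - j)) = J * (2 * c + J.+1))%N.
Proof.
elim: J => [|J IH]; first by rewrite big_ord0.
by rewrite big_ord_recl [LHS]mulnDr IH /=; lia.
Qed.

(** The numbers I - i and J - j average (I + 1) / 2 and (J + 1) / 2, so the summand averages (I + J)
    / 2. *)
Lemma sum_box (I J : nat) :
  (2 * \sum_(i < I) \sum_(j < J) (I - i + (J - j)).-1 = I * J * (I + J))%N.
Proof.
have -> : (\sum_(i < I) \sum_(j < J) (I - i + (J - j)).-1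
        = \sum_(i < I) \sum_(j < J) ((I - i).-1 + (J - j)))%N.
  by apply: eq_bigr => i _; apply: eq_bigr => j _; have := ltn_ord i; lia.
elim: I => [|I IH]; first by rewrite big_ord0.
rewrite big_ord_recl [LHS]mulnDr sum_lin IH /=; lia.
Qed.

Lemma sum_inner (i M : nat) :
  (6 * \sum_(j < M) i.+1 * j.+1 * (i + j).+2 = i.+1 * M * M.+1 * (2 * M + 3 * i + 4))%N.
Proof.
elim: M => [|M IH]; first by rewrite big_ord0; lia.
by rewrite big_ord_recr [LHS]mulnDr /= IH; lia.
Qed.

(** The offset c makes the induction work: removing the row i = 0 replaces (K + 1, c) by (K, c + 1).
    Only c = 0 enters [sum_outer]. *)
Lemma sum_mid (c K : nat) :
  (60 * \sum_(i < K) \sum_(j < K - i) (i + c).+1 * j.+1 * (i + c + j).+2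
   = K * K.+1 * K.+2 * (2 * K ^ 2 + 9 * K + 9 + 10 * c * K + 20 * c + 10 * c ^ 2))%N.
Proof.
elim: K c => [|K IH] c; first by rewrite big_ord0; lia.
rewrite big_ord_recl [LHS]mulnDr /=.
have := IH c.+1; have := sum_inner c K.+1.
under [in X in _ -> X -> _]eq_bigr => i _ do under eq_bigr => j _ do rewrite addnS -addSn.
rewrite !add0n subn0; set S := \sum_(i < K.+1) _; set S' := \sum_(i < K) _.
by move: S S' => S S'; lia.
Qed.

Lemma sum_outer (N : nat) :
  (180 * \sum_(t in triples N) t.1.2.+1 * t.2.+1 * (t.1.2 + t.2).+2
   = N * N.+1 * N.+2 ^ 2 * N.+3 * N.+4)%N.
Proof.
rewrite (sum_triples N (fun _ i j => i.+1 * j.+1 * (i + j).+2)%N).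
elim: N => [|N IH]; first by rewrite big_ord0.
rewrite big_ord_recl [LHS]mulnDr IH subn0 /=; have := sum_mid 0 N.+1.
rewrite (_ : \sum_(i < N.+1) \sum_(j < N.+1 - i) (i + 0).+1 * j.+1 * (i + 0 + j).+2
           = \sum_(i < N.+1) \sum_(j < N.+1 - i) i.+1 * j.+1 * (i + j).+2)%N; last first.
  by apply: eq_bigr => i _; apply: eq_bigr => j _; rewrite addn0.
set S := \sum_(i < N.+1) _; move: S => S; lia.
Qed.

(** For fixed i <= i' and j <= j', the admissible a run from a' to a' + (i' - i) + (j' - j); the
    numbers of choices add up to [sum_box]. *)
Lemma card_below N (u : 'I_N * 'I_N * 'I_N) : u \in triples N ->
  (2 * \sum_(t in triples N) below t u = u.1.2.+1 * u.2.+1 * (u.1.2 + u.2).+2)%N.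
Proof.
case: u => -[a' i'] j'; rewrite inE /below /= => uN.
rewrite (sum_triplesE N (fun a i j =>
  [&& a' <= a, i <= i', j <= j' & a + i + j <= a' + i' + j'] : nat)%N).
rewrite exchange_big /=.
under eq_bigr do rewrite exchange_big /=.
rewrite -addnS -addSn -sum_box; congr (2 * _)%N.
rewrite (big_ord_widen N (fun i => \sum_(j < j'.+1) (i'.+1 - i + (j'.+1 - j)).-1)%N) ?ltn_ord //.
rewrite [RHS]big_mkcond; apply: eq_bigr => i _ /=.
case: ltnP => ii; last first.
  by apply: big1 => j _; apply: big1 => a _; case: ifP => //; lia.
rewrite (big_ord_widen N (fun j => (i'.+1 - i + (j'.+1 - j)).-1)%N) ?ltn_ord //.
rewrite [RHS]big_mkcond; apply: eq_bigr => j _ /=.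
case: ltnP => jj; last first.
  by apply: big1 => a _; case: ifP => //; lia.
transitivity (\sum_(0 <= a < N) (a' <= a < (a' + i' + j').+1 - i - j))%N.
  rewrite big_mkord; apply: eq_bigr => a _.
  by case: ifP; lia.
rewrite sum_interval; lia.
Qed.

Lemma card_below_pairs N :
  (360 * \sum_(u in triples N) \sum_(t in triples N) below t u
   = N * N.+1 * N.+2 ^ 2 * N.+3 * N.+4)%N.
Proof.
rewrite -sum_outer -[360%N]/(180 * 2)%N -mulnA; congr (180 * _)%N.
by rewrite big_distrr; apply: eq_bigr => u /card_below.
Qed.

(** * From counts to probabilities *)

Local Open Scope classical_set_scope.
Local Open Scope ring_scope.

Lemma indep_prob_uniform (R : realType) (T : finType) (A : {set T}) (E : T -> T -> bool) :
  indep_prob (uniform_pmf R A) (uniform_pmf R A) E =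
  (\sum_(x in A) \sum_(y in A) E x y)%N%:R / #|A|%:R ^+ 2.
Proof.
rewrite natr_sum mulr_suml [RHS]big_mkcond /=; apply: eq_bigr => x _.
rewrite /uniform_pmf; case: ifP => xA; last first.
  by rewrite big1 // => y _; rewrite mul0r.
rewrite natr_sum mulr_suml big_mkcond [RHS]big_mkcond /=; apply: eq_bigr => y _.
case: (E x y); case: (y \in A); rewrite ?mulr0 ?mul0r //.
by rewrite mul1r expr2 invfM.
Qed.

Lemma sum_bigrassmannian N (E : 'S_N.+1 -> 'S_N.+1 -> bool) :
  (\sum_(x in bigrassmannian N.+1) \sum_(y in bigrassmannian N.+1) E x y
   = \sum_(t in triples N) \sum_(u in triples N) E (bgt t) (bgt u))%N.
Proof.
rewrite bigrassmannianE big_imset /=; last exact: bgt_inj.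
by apply: eq_bigr => t _; rewrite big_imset //; exact: bgt_inj.
Qed.

Lemma card_bigrassmannian N : (6 * #|bigrassmannian N.+1| = N * N.+1 * N.+2)%N.
Proof. by rewrite bigrassmannianE card_in_imset ?card_triples //; exact: bgt_inj. Qed.

Lemma card_le_pairs N :
  (360 * \sum_(x in bigrassmannian N.+1) \sum_(y in bigrassmannian N.+1) bruhat_le x y
   = N * N.+1 * N.+2 ^ 2 * N.+3 * N.+4)%N.
Proof.
rewrite sum_bigrassmannian exchange_big -card_below_pairs; congr (_ * _)%N.
by apply: eq_bigr => u uN; apply: eq_bigr => t tN; rewrite bruhat_bgt.
Qed.

(** Inclusion-exclusion over the two directions: by antisymmetry both hold exactly on the
    diagonal. *)
Lemma card_comparable_pairs N :
  (\sum_(x in bigrassmannian N.+1) \sum_(y in bigrassmannian N.+1) bruhat_comparable x y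
   + #|bigrassmannian N.+1|
   = 2 * \sum_(x in bigrassmannian N.+1) \sum_(y in bigrassmannian N.+1) bruhat_le x y)%N.
Proof.
rewrite mul2n -addnn [X in _ = (_ + X)%N]exchange_big /= !sum_bigrassmannian.
have -> : #|bigrassmannian N.+1| = (\sum_(t in triples N) \sum_(u in triples N) (t == u))%N.
  rewrite bigrassmannianE card_in_imset; last exact: bgt_inj.
  rewrite -sum1_card; apply: eq_bigr => t tN.
  by rewrite (bigD1 t) //= eqxx big1 ?addn0 // => u /andP[_]; rewrite eq_sym => /negPf->.
rewrite -!big_split; apply: eq_bigr => t tN; rewrite -!big_split; apply: eq_bigr => u uN /=.
rewrite /bruhat_comparable !bruhat_bgt //.
have : (t == u) = below t u && below u t.
  apply/eqP/idP => [->|/below_anti//]; by rewrite /below !leqnn.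
by case: (t == u); case: (below t u); case: (below u t).
Qed.

(** The quotient of (n - 1) n (n + 1)^2 (n + 2) (n + 3) / 360 by the square of (n - 1) n (n + 1) /
    6. *)
Lemma p_leE (R : realType) n : (2 <= n)%N ->
  p_le R n = (n%:R + 2) * (n%:R + 3) / (10 * n%:R * (n%:R - 1)).
Proof.
case: n => [|[|N]] // _; rewrite /p_le indep_prob_uniform.
have := card_le_pairs N.+1; have := card_bigrassmannian N.+1.
set M := #|_|; set P := (\sum_(_ in _) _)%N => MN PN.
have {MN} -> : M%:R = N.+1%:R * N.+2%:R * N.+3%:R / 6 :> R.
  by rewrite -!natrM -MN natrM mulrC mulKf // pnatr_eq0.
have {PN} -> : P%:R = N.+1%:R * N.+2%:R * N.+3%:R ^+ 2 * N.+4%:R * N.+4.+1%:R / 360 :> R.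
  by rewrite -natrX -!natrM -PN natrM mulrC mulKf // pnatr_eq0.
rewrite -!natr1; have : 0 <= N%:R :> R by []. move: (N%:R) => x x0.
by field; rewrite !gt_eqF //; lra.
Qed.

Lemma p_comparableE (R : realType) n : (2 <= n)%N ->
  p_comparable R n = 2 * p_le R n - 6 / ((n%:R - 1) * n%:R * (n%:R + 1)).
Proof.
case: n => [|[|N]] // _; rewrite /p_comparable /p_le !indep_prob_uniform.
have := card_comparable_pairs N.+1; have := card_bigrassmannian N.+1.
set M := #|_|; set C := (\sum_(_ in _) _)%N; set P := (\sum_(_ in _) _)%N => MN CP.
have MR : M%:R = N.+1%:R * N.+2%:R * N.+3%:R / 6 :> R.
  by rewrite -!natrM -MN natrM mulrC mulKf // pnatr_eq0.
have -> : C%:R = 2 * P%:R - M%:R :> R by rewrite -natrM -CP natrD addrK.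
rewrite MR -!natr1; have : 0 <= N%:R :> R by []. move: (N%:R) (P%:R) => x y x0.
by field; rewrite !gt_eqF //; lra.
Qed.

(** * Monotonicity, limits and series *)

Lemma p_le_decr (R : realType) m n : (2 <= m)%N -> (m < n)%N -> p_le R n < p_le R m.
Proof.
move=> m2 mn; rewrite !p_leE //; last lia.
have : 2 <= m%:R :> R by rewrite ler_nat.
have : m%:R < n%:R :> R by rewrite ltr_nat.
move: m%:R n%:R => y z yz y2; rewrite -subr_gt0.
have -> : (y + 2) * (y + 3) / (10 * y * (y - 1)) - (z + 2) * (z + 3) / (10 * z * (z - 1))
  = 6 * (z - y) * (y * z + y + z - 1) / (10 * (y * (y - 1)) * (z * (z - 1))).
  by field; rewrite !gt_eqF //; lra.
by apply: divr_gt0; do ?apply: mulr_gt0; nra.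
Qed.

Lemma p_comparable_decr (R : realType) m n : (2 <= m)%N -> (m < n)%N ->
  p_comparable R n < p_comparable R m.
Proof.
move=> m2 mn; rewrite !p_comparableE ?p_leE //; try lia.
have : 2 <= m%:R :> R by rewrite ler_nat.
have : m%:R < n%:R :> R by rewrite ltr_nat.
move: m%:R n%:R => y z yz y2; rewrite -subr_gt0.
(* The cofactor of z - y is grouped into terms nonnegative for y, z >= 2 and a quadratic in y z that
   is positive for y z >= 4. *)
rewrite (_ : _ - _ = 6 * (z - y)
   * (2 * y ^+ 2 * (z - 2) + 2 * z ^+ 2 * (y - 2) + ((y * z) ^+ 2 - 3 * (y * z) + 4))
   / (5 * (y * (y - 1) * (y + 1)) * (z * (z - 1) * (z + 1)))); last first.
  by field; rewrite !gt_eqF //; lra.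
have yz4 : 4 <= y * z by nra.
apply: divr_gt0; do ?apply: mulr_gt0; try lra.
apply: ltr_wpDl; first by apply: addr_ge0; apply: mulr_ge0; nra.
nra.
Qed.

(** Partial sums telescope, with - c w^k / (1 - w) as discrete primitive. *)
Lemma cvg_geometric_tail (R : realType) (u : nat -> R) (c w : R) m : `|w| < 1 ->
  (forall k, u k = c * w ^+ k) ->
  (fun N => \sum_(m <= k < N) u k) @ \oo --> c * w ^+ m / (1 - w).
Proof.
move=> w1 uE; have w1' : 1 - w != 0.
  by rewrite subr_eq0 eq_sym; apply: contraTneq w1 => ->; rewrite normr1 ltxx.
have E : (fun N => c * w ^+ m / (1 - w) - w ^+ N * (c / (1 - w))) @ \oo
    --> c * w ^+ m / (1 - w) - 0 * (c / (1 - w)).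
  by apply: cvgB; [exact: cvg_cst | apply: cvgMr_tmp; exact: cvg_expr].
rewrite mul0r subr0 in E; apply: cvg_trans E; apply: near_eq_cvg; near=> N.
have mN : (m <= N)%N by near: N; exact: nbhs_infty_ge.
rewrite (telescope_sumr_eq (fun k => - (w ^+ k * (c / (1 - w))))) //=; last first.
  by move=> k _; rewrite uE exprS; field.
by field.
Unshelve. all: by end_near. Qed.

Lemma natr_inv_cvg0 (R : realType) : (n%:R : R)^-1 @[n --> \oo] --> (0 : R).
Proof. by rewrite -cvg_shiftS; exact: cvg_harmonic. Qed.

Lemma p_le_cvg (R : realType) : p_le R n @[n --> \oo] --> (1 / 10 : R).
Proof.
have z0 := @natr_inv_cvg0 R.
(* The closed form with numerator and denominator divided by n^2; the two agree from n = 2 on. *)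
have E : (1 + 2 * (n%:R : R)^-1) * (1 + 3 * (n%:R : R)^-1) / (10 * (1 - (n%:R : R)^-1))
    @[n --> \oo] --> ((1 + 2 * 0) * (1 + 3 * 0) / (10 * (1 - 0)) : R).
  apply: cvgM.
    by apply: cvgM; apply: cvgD; (try exact: cvg_cst); apply: cvgMl_tmp.
  apply: cvgV; first by rewrite subr0 mulr1 pnatr_eq0.
  by apply: cvgMl_tmp; apply: cvgB => //; exact: cvg_cst.
rewrite !mulr0 addr0 subr0 !mulr1 in E; apply: cvg_trans E; apply: near_eq_cvg; near=> n.
have n2 : (2 <= n)%N by near: n; exact: nbhs_infty_ge.
rewrite p_leE //; have : 2 <= n%:R :> R by rewrite ler_nat.
by move: n%:R => y y2; field; rewrite !gt_eqF //; lra.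
Unshelve. all: by end_near. Qed.

Lemma p_comparable_cvg (R : realType) : p_comparable R n @[n --> \oo] --> (1 / 5 : R).
Proof.
have z0 := @natr_inv_cvg0 R.
have E : 2 * p_le R n - 6 * ((n%:R : R)^-1 * ((n%:R : R)^-1 * (n%:R : R)^-1))
     / (1 - (n%:R : R)^-1 * (n%:R : R)^-1)
    @[n --> \oo] --> (2 * (1 / 10) - 6 * (0 * (0 * 0)) / (1 - 0 * 0) : R).
  apply: cvgB; first by apply: cvgMl_tmp; exact: p_le_cvg.
  apply: cvgM; first by apply: cvgMl_tmp; apply: cvgM => //; exact: cvgM.
  apply: cvgV; first by rewrite mul0r subr0 oner_eq0.
  by apply: cvgB; [exact: cvg_cst | exact: cvgM].
have e5 : 2 * (1 / 10) - 6 * (0 * (0 * 0)) / (1 - 0 * 0) = 1 / 5 :> R by field.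
rewrite e5 in E; apply: cvg_trans E; apply: near_eq_cvg; near=> n.
have n2 : (2 <= n)%N by near: n; exact: nbhs_infty_ge.
rewrite p_comparableE //; have : 2 <= n%:R :> R by rewrite ler_nat.
move: n%:R (p_le R n) => y p y2; congr (_ - _).
by field; rewrite !gt_eqF //; nra.
Unshelve. all: by end_near. Qed.

Theorem corollary5p3 (R : realType) :
  (forall n : nat, (2 <= n)%N ->
     [/\ cvgn (fun N : nat => \sum_(1 <= k < N)
                 (12 / (5 * n%:R ^+ (2 * k)) - 18 / (5 * n%:R ^+ (2 * k + 1)) : R)),
         p_comparable R n =
           1 / 5 + 6 / (5 * n%:R)
           + \big[+%R/0]_(1 <= k <oo)
               (12 / (5 * n%:R ^+ (2 * k)) - 18 / (5 * n%:R ^+ (2 * k + 1)) : R),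
         cvgn (fun N : nat => \sum_(2 <= k < N) (6 / (5 * n%:R ^+ k) : R))
       & p_le R n =
           1 / 10 + 3 / (5 * n%:R) + \big[+%R/0]_(2 <= k <oo)
               (6 / (5 * n%:R ^+ k) : R)])
  /\ ((forall m n : nat, (2 <= m)%N -> (m < n)%N ->
         p_comparable R n < p_comparable R m)
      /\ p_comparable R n @[n --> \oo] --> (1 / 5 : R))
  /\ ((forall m n : nat, (2 <= m)%N -> (m < n)%N -> p_le R n < p_le R m)
      /\ p_le R n @[n --> \oo] --> (1 / 10 : R)).
Proof.
split; last first.
  split; split; [exact: p_comparable_decr | exact: p_comparable_cvg
    | exact: p_le_decr | exact: p_le_cvg].
move=> n n2; have y2 : 2 <= n%:R :> R by rewrite ler_nat.
have y0 : n%:R != 0 :> R by rewrite gt_eqF //; lra.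
have z1 : `|(n%:R : R)^-1| < 1.
  by rewrite gtr0_norm ?invr_gt0 ?invf_lt1; lra.
have w1 : `|(n%:R : R) ^- 2| < 1 by rewrite -exprVn normrX exprn_ilt1.
(* Both series are geometric, of ratios 1/n and 1/n^2. Their sums are 6 / (5 n (n - 1)) and (12 n -
   18) / (5 n (n^2 - 1)), which leaves rational identities. *)
have u1 k : 6 / (5 * n%:R ^+ k) = 6 / 5 * n%:R^-1 ^+ k :> R.
  by rewrite exprVn; field; rewrite ?y0 ?expf_neq0.
have u2 k : 12 / (5 * n%:R ^+ (2 * k)) - 18 / (5 * n%:R ^+ (2 * k + 1))
    = (12 / 5 - 18 / 5 / n%:R) * n%:R ^- 2 ^+ k :> R.
  by rewrite exprVn -exprM exprD expr1; field; rewrite ?y0 ?expf_neq0.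
have S1 := cvg_geometric_tail (m := 2) z1 u1.
have S2 := cvg_geometric_tail (m := 1) w1 u2.
split; [exact: cvgP S2 | | exact: cvgP S1 |].
  rewrite (cvg_lim _ S2) // p_comparableE // p_leE //.
  by move: n%:R y2 => y y2; field; rewrite !gt_eqF //; nra.
rewrite (cvg_lim _ S1) // p_leE //.
by move: n%:R y2 => y y2; field; rewrite !gt_eqF //; nra.
Qed.
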